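(* There is an absolute constant $C>0$ such that the following holds for every positive integer $n$ and every Sidon set $S=\{a_1<a_2<\cdots<a_t\}\subset\{1,2,\ldots,n\}$ (with $t=|S|$): if $t\geqslant n^{1/2}-n^{1/4}$, then $$\left|\sum_{i=1}^t (n+1-i)a_i-\frac{1}{2}n^2t\right|\leqslant C\, n^{19/8},$$ and if $t<n^{1/2}-n^{1/4}$, then $$\left|\sum_{i=1}^t (n+1-i)a_i-\frac{1}{2}n^2t\right|\leqslant C\, n^{9/4}\sqrt{n^{1/2}-t}.$$
   Context: A set $S\subset\{1,2,\ldots,n\}$ is called a Sidon set if all the sums $a+b$ with $a,b\in S$ are different (up to the order of the summands, i.e. the sums $a+b$ with $a\leqslant b$, $a,b\in S$, are pairwise distinct). *)

(* Defs.v *)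
From HB Require Import structures.
From mathcomp Require Import all_boot all_order all_algebra.
From mathcomp Require Import finmap.
From mathcomp Require Import reals exp.

Set Implicit Arguments.
Unset Strict Implicit.
Unset Printing Implicit Defensive.

Definition sidon (S : {fset nat}) : Prop :=
  forall a b c d : nat, a \in S -> b \in S -> c \in S -> d \in S ->
    a <= b -> c <= d -> a + b = c + d -> a = c /\ b = d.

(* The indexing is 1-based: a_1 < a_2 < ... < a_t lists S, where t = #|` S|;
   the value is the dummy 0 for i > t (and that of a_1 for i = 0). *)
Definition nth_elt (S : {fset nat}) (i : nat) : nat :=
  nth 0 (sort leq S) i.-1.

(* Main.v *)
Require Import Defs.
From HB Require Import structures.
From mathcomp Require Import all_boot all_order all_algebra.
From mathcomp Require Import finmap.
From mathcomp Require Import reals exp.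
From mathcomp Require Import zify ring lra.

Set Implicit Arguments.
Unset Strict Implicit.
Unset Printing Implicit Defensive.

Import Order.TTheory GRing.Theory Num.Theory.
Local Open Scope ring_scope.

(** Write [t] for the size of [S], and [E] for the sum of [a - n / 2] over the
    elements [a] of [S].  Since [i <= t = O(n^(1/2))], replacing each weight
    [n + 1 - i] by [n] costs only [t^2 n = O(n^2)], which both error terms
    absorb.  So the theorem says that [E] is [O(n^(11/8))], respectively
    [O(n^(5/4) (n^(1/2) - t)^(1/2))]: a dense Sidon set has its centre of mass
    near [n / 2].

    The proof is the window argument of Erdos and Turan.  Slide a window of
    length [u] along the integers and let [A k] be the number of elements of
    [S] in the [k]-th of the [m = n + u] positions.  The sum of [A k ^+ 2]
    counts the pairs [(a, b)] weighted by the overlap of their windows, which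
    is [u - |a - b|] when positive.  In a Sidon set each positive difference
    occurs at most once, hence this sum is at most [t u + u^2]
    ([sidon_sum_overlap]).  As the mean of [A] is [t u / m], its variance is
    small when [t] is close to [n^(1/2)].  On the other hand the sum of
    [(k - (m - 1) / 2) A k] is exactly [u E], so that Cauchy-Schwarz yields
    [u E^2 <= m^2 (m (t + u) - t^2 u)] ([sidon_deviation]).

    The terms [m t / u] and [m - n] of this bound balance at [u = n^(3/4)].
    With that choice [E^2] is [O(n^2 (n^(1/4) t + n^(3/4) + n - t^2))]
    ([sidon_deviation_optimized]), and the two regimes of the theorem are the
    cases where [n - t^2] is [O(n^(3/4))] and where it dominates.  All the real
    powers of [n] that occur are integral powers of [q = n^(1/8)]. *)

(** * Counting in sliding windows *)

(** The windows that contain [a] are those with [a <= k < a + u]: no window has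
    a negative index, and [k < n + u] suffices for elements up to [n]. *)
Definition window_count (s : seq nat) (u k : nat) : nat :=
  count (fun a => a <= k < a + u)%N s.

(** Double counting; taking [f] to be [1], the identity and the window count
    itself gives the total mass, the first moment and the second moment. *)
Lemma sum_window_count (R : pzRingType) (s : seq nat) (n u : nat) (f : nat -> R) :
  (forall a, a \in s -> a <= n)%N ->
  \sum_(0 <= k < n + u) f k * (window_count s u k)%:R =
  \sum_(a <- s) \sum_(a <= k < a + u) f k.
Proof.
move=> sn.
under eq_bigr => k _.
  rewrite /window_count -sum1_count natr_sum mulr_sumr big_mkcond /=.
  under eq_bigr => a _ do rewrite mulr1.
  over.
rewrite exchange_big /=; apply: eq_big_seq => a /sn an.
rewrite -big_mkcond /= (big_nat_widenl a 0) //
  (big_nat_widen _ (a + u) (n + u)) ?leq_add2r //.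
Qed.

Lemma window_overlap (u a b : nat) :
  (\sum_(a <= k < a + u) (b <= k < b + u) = u - (a - b) - (b - a))%N.
Proof.
have -> : (\sum_(a <= k < a + u) (b <= k < b + u) =
           \sum_(maxn a b <= k < minn a b + u) 1)%N.
  rewrite -big_mkcond (big_nat_widenl (maxn a b) a) ?leq_maxl //=.
  rewrite [RHS](big_nat_widen _ _ (a + u)) ?leq_add2r ?geq_minl //.
  rewrite big_nat_cond [RHS]big_nat_cond; apply: eq_bigl => k.
  rewrite geq_max addn_minl leq_min.
  by case: (a <= k)%N; case: (b <= k)%N; case: (k < a + u)%N; case: (k < b + u)%N.
by rewrite sum_nat_const_nat; lia.
Qed.

(** * Differences in a Sidon set *)

(** [b - a = d - c] is the coincidence of sums [a + d = c + b], and
    [{a, d} = {c, b}] leaves only [a = c] because [a < b]. *)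
Lemma sidon_sub_inj (S : {fset nat}) (a b c d : nat) : sidon S ->
  a \in S -> b \in S -> c \in S -> d \in S ->
  (a < b)%N -> (c < d)%N -> (b - a = d - c)%N -> a = c /\ b = d.
Proof.
move=> sS aS bS cS dS ab cd e.
have h : (a + d = c + b)%N by lia.
have [ad|da] := leqP a d; have [cb|bc] := leqP c b.
- by have [-> ->] := sS a d c b aS dS cS bS ad cb h.
- have := sS a d b c aS dS bS cS ad (ltnW bc); lia.
- have := sS d a c b dS aS cS bS (ltnW da) cb; lia.
- lia.
Qed.

(** The map from pairs to differences is injective, so the left-hand side is a
    sub-sum of the right-hand one. *)
Lemma sidon_sum_sub (S : {fset nat}) (F : nat -> nat) (u : nat) : sidon S ->
  (forall d, u <= d -> F d = 0)%N ->
  (\sum_(a <- S) \sum_(b <- S | a < b) F (b - a) <= \sum_(1 <= d < u) F d)%N.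
Proof.
move=> sS F0.
(* Only differences below u enter the sum on the right. *)
pose P := [seq p <- [seq (a, b) | a <- S, b <- S]
          | (p.1 < p.2)%N && (p.2 - p.1 < u)%N].
have mP a b : (a, b) \in P -> [/\ a \in S, b \in S, (a < b)%N & (b - a < u)%N].
  rewrite mem_filter /= => /andP[/andP[ab abu]] /allpairsP[[x y] /= [xS yS e]].
  by case: e ab abu => -> -> *; split.
have -> : (\sum_(a <- S) \sum_(b <- S | a < b) F (b - a) =
           \sum_(d <- [seq (p.2 - p.1)%N | p <- P]) F d)%N.
  rewrite big_map big_filter [RHS]big_mkcond /= big_allpairs /=.
  apply: eq_bigr => a _; rewrite [LHS]big_mkcond /=; apply: eq_bigr => b _.
  case: ltnP => //= _; case: ltnP => // /F0 //.
apply: (@uniq_sub_le_big _ addn leq) => //; first by move=> *; exact: leq_addr.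
- rewrite map_inj_in_uniq; last first.
    move=> [a b] [c d] /mP[aS bS ab _] /mP[cS dS cd _] /= e.
    by have [-> ->] := sidon_sub_inj sS aS bS cS dS ab cd e.
  by apply/filter_uniq/allpairs_uniq => // -[? ?] [? ?] _ _ /= [-> ->].
- exact: iota_uniq.
move=> d /mapP[[a b] /mP[_ _ ab abu] -> /=].
by rewrite mem_index_iota abu subn_gt0 ab.
Qed.

(** The diagonal contributes [t u]; each of the two off-diagonal halves is at
    most the sum of [u - d] over [0 < d < u], that is ['C(u, 2)]. *)
Lemma sidon_sum_overlap (S : {fset nat}) (u : nat) : sidon S ->
  (\sum_(a <- S) \sum_(b <- S) (u - (a - b) - (b - a)) <= #|` S|%fset * u + u ^ 2)%N.
Proof.
move=> sS; pose T := (\sum_(a <- S) \sum_(b <- S | a < b) (u - (b - a)))%N.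
have -> : (\sum_(a <- S) \sum_(b <- S) (u - (a - b) - (b - a)) =
           #|` S|%fset * u + (T + T))%N.
  have {2}-> : T = (\sum_(a <- S) \sum_(b <- S | b < a) (u - (a - b)))%N.
    rewrite /T (exchange_big_dep xpredT) //=.
  have -> : (#|` S|%fset * u = \sum_(a <- S) \sum_(b <- S | b == a) u)%N.
    rewrite cardfE -[LHS]sum_nat_const big_seq_fsetE /=.
    apply: eq_bigr => -[a aS] _ /=.
    by rewrite -big_filter filter_pred1_uniq ?fset_uniq //= big_seq1.
  rewrite /T -!big_split /=; apply: eq_bigr => a _.
  rewrite [in RHS]big_mkcond [X in (_ + (X + _))%N]big_mkcond [X in (_ + (_ + X))%N]big_mkcond.
  rewrite -!big_split /=; apply: eq_bigr => b _.
  case: (ltngtP a b) => h; rewrite ?ltnn /=; lia.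
have T1 : (T <= 'C(u, 2))%N.
  rewrite -bin2_sum; case: u @T => [|u] T.
    by rewrite /T big1 // => a _; rewrite big1.
  apply: leq_trans (sidon_sum_sub sS (F := fun d => (u.+1 - d)%N) (u := u.+1) _) _.
    by move=> d; rewrite -subn_eq0 => /eqP.
  rewrite big_add1 /= big_nat_rev /= [leqRHS]big_nat_recl // add0n.
  by rewrite [leqLHS](eq_big_nat _ _ (F2 := fun i => i.+1)) // => i /andP[_ iu]; lia.
rewrite leq_add2l addnn; apply: leq_trans (_ : 'C(u, 2).*2 <= _)%N; first lia.
rewrite bin2; have := leq_mul (leqnn u) (leq_pred u); rewrite -mulnn.
by have := odd_double_half (u * u.-1); lia.
Qed.

(** * The deviation of the centre of mass *)

Lemma cauchy_schwarz (R : realFieldType) (I : Type) (r : seq I) (x y : I -> R) :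
  (\sum_(i <- r) x i * y i) ^+ 2 <=
  (\sum_(i <- r) x i ^+ 2) * (\sum_(i <- r) y i ^+ 2).
Proof.
set P := \sum_(i <- r) x i * y i; set X := \sum_(i <- r) x i ^+ 2.
set Y := \sum_(i <- r) y i ^+ 2.
have quad c d : 0 <= c ^+ 2 * X - 2 * c * d * P + d ^+ 2 * Y.
  rewrite /X /Y /P !mulr_sumr -sumrB -big_split /= sumr_ge0 // => i _.
  have := sqr_ge0 (c * x i - d * y i); lra.
have X0 : 0 <= X by have := quad 1 0; lra.
have Y0 : 0 <= Y by have := quad 0 1; lra.
(* The quadratic form at (P, X) and (Y, P) gives X (X Y - P^2) >= 0 and
   Y (X Y - P^2) >= 0; adding them treats X and Y alike. *)
have [XY0|XY0] := leP (X + Y) 0.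
  by have := quad 1 1; have := quad 1 (- 1); nra.
rewrite -subr_ge0 -(pmulr_rge0 _ XY0).
by have := quad P X; have := quad Y P; lra.
Qed.

Lemma sum_natr_interval (R : realFieldType) (a m : nat) :
  \sum_(a <= k < a + m) k%:R = m%:R * (a%:R + (m%:R - 1) / 2) :> R.
Proof.
elim: m => [|m IH]; first by rewrite addn0 big_geq // mul0r.
by rewrite addnS big_nat_recr ?leq_addr //= IH natrD -natr1; field.
Qed.

(** Cauchy-Schwarz applied to [k] and [A k], both centred.  The count is
    scaled by [m] so that its mean is [t u] and no division occurs. *)
Lemma sidon_deviation (R : realFieldType) (S : {fset nat}) (n u : nat) :
  sidon S -> (forall a, a \in S -> a <= n)%N -> (0 < u)%N ->
  u%:R * (\sum_(a <- S) (a%:R - n%:R / 2)) ^+ 2 <=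
  (n + u)%:R ^+ 2 * ((n + u)%:R * ((#|` S|%fset)%:R + u%:R)
                     - (#|` S|%fset)%:R ^+ 2 * u%:R) :> R.
Proof.
move=> sS Sn u0; set t : R := (#|` S|%fset)%:R; set m : R := (n + u)%:R.
set E := \sum_(a <- S) _; set U : R := u%:R.
have U0 : 0 < U by rewrite ltr0n.
have m0 : 0 < m by rewrite ltr0n addn_gt0 u0 orbT.
pose A k : R := (window_count S u k)%:R.
have sumS c : \sum_(a <- S) c = t * c :> R.
  by rewrite big_const_seq count_predT iter_addr_0 -[LHS]mulr_natl.
have sum1 : \sum_(0 <= k < n + u) 1 = m by rewrite sumr_const_nat subn0.
have sumk : \sum_(0 <= k < n + u) k%:R = m * ((m - 1) / 2).
  by rewrite -[X in index_iota _ X]add0n sum_natr_interval add0r.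
have sumA : \sum_(0 <= k < n + u) A k = t * U.
  under eq_bigr => k _ do rewrite -[A k]mul1r.
  rewrite (sum_window_count u (fun=> 1) Sn) -sumS; apply: eq_bigr => a _.
  by rewrite sumr_const_nat addKn.
have sumkA : \sum_(0 <= k < n + u) k%:R * A k = U * (E + t * ((m - 1) / 2)).
  rewrite (sum_window_count u _ Sn) -sumS -big_split /= mulr_sumr.
  by apply: eq_bigr => a _; rewrite sum_natr_interval /m natrD /U; field.
have sumAA : \sum_(0 <= k < n + u) A k ^+ 2 <= U * (t + U).
  under eq_bigr => k _ do rewrite expr2.
  rewrite (sum_window_count u A Sn).
  have -> : U * (t + U) = (#|` S|%fset * u + u ^ 2)%:R.
    by rewrite natrD natrM natrX /U; ring.
  apply: le_trans (_ : (\sum_(a <- S) \sum_(b <- S) (u - (a - b) - (b - a)))%:R <= _).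
    rewrite natr_sum ler_sum // => a _; rewrite /A -natr_sum ler_nat.
    under eq_bigr => k _ do rewrite /window_count -sum1_count big_mkcond /=.
    rewrite exchange_big /=; apply: leq_sum => b _.
    rewrite -window_overlap; apply: leq_sum => k _; by case: ifP.
  by rewrite ler_nat sidon_sum_overlap.
have := cauchy_schwarz (index_iota 0 (n + u))
  (fun k => k%:R - (m - 1) / 2) (fun k => m * A k - t * U).
have -> : \sum_(0 <= k < n + u) (k%:R - (m - 1) / 2) * (m * A k - t * U) = m * U * E.
  pose c := (m - 1) / 2.
  rewrite (eq_bigr (fun k => m * (k%:R * A k) - t * U * k%:R - m * c * A k
                             + c * t * U * 1)); last first.
    by move=> k _; rewrite /c; ring.
  by rewrite big_split /= !sumrB -!mulr_sumr sumkA sumk sumA sum1 /c; field.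
have VE : \sum_(0 <= k < n + u) (m * A k - t * U) ^+ 2 =
  m ^+ 2 * (\sum_(0 <= k < n + u) A k ^+ 2) - m * t ^+ 2 * U ^+ 2.
  rewrite (eq_bigr (fun k => m ^+ 2 * A k ^+ 2 - 2 * m * t * U * A k
                             + t ^+ 2 * U ^+ 2 * 1)); last first.
    by move=> k _; ring.
  rewrite big_split /= sumrB -!mulr_sumr sumA sum1; ring.
have V0 : 0 <= \sum_(0 <= k < n + u) (m * A k - t * U) ^+ 2.
  by rewrite sumr_ge0 // => k _; exact: sqr_ge0.
(* The exact value is of order m^3 / 12; only the order matters. *)
have X3 : \sum_(0 <= k < n + u) (k%:R - (m - 1) / 2) ^+ 2 <= m ^+ 3.
  have -> : m ^+ 3 = \sum_(0 <= k < n + u) 1 * m ^+ 2.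
    by rewrite -mulr_suml sum1 -exprS.
  apply: ler_sum_nat => k /andP[_ km].
  have k0 : 0 <= k%:R :> R by rewrite ler0n.
  have k1 : k%:R + 1 <= m by rewrite natr1 ler_nat.
  nra.
set W := m * (t + U) - t ^+ 2 * U.
have VW : \sum_(0 <= k < n + u) (m * A k - t * U) ^+ 2 <= m * U * W.
  have := ler_wpM2l (sqr_ge0 m) sumAA; rewrite VE /W; lra.
have X0 : 0 <= \sum_(0 <= k < n + u) (k%:R - (m - 1) / 2) ^+ 2.
  by rewrite sumr_ge0 // => k _; exact: sqr_ge0.
move=> h; have {h} := le_trans h (ler_pM X0 V0 X3 VW).
have -> : (m * U * E) ^+ 2 = m ^+ 2 * U * (U * E ^+ 2) by ring.
have -> : m ^+ 3 * (m * U * W) = m ^+ 2 * U * (m ^+ 2 * W) by ring.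
by rewrite ler_pM2l // mulr_gt0 // exprn_gt0.
Qed.

(** * Choice of the window length *)

(** With [q^6 <= U <= 2 q^6], the bound divided by [U] implies
    [E^2 <= M^2 W], where [M = N + U <= 3 q^8].  It also controls [t]: if [t]
    exceeds [6 q^4], then [W] is negative. *)
Lemma deviation_bound_of_scale (R : realFieldType) (q t E N U : R) :
  1 <= q -> 0 <= t ->
  N = q ^+ 8 -> q ^+ 6 <= U -> U <= 2 * q ^+ 6 ->
  U * E ^+ 2 <= (N + U) ^+ 2 * ((N + U) * (t + U) - t ^+ 2 * U) ->
  t <= 6 * q ^+ 4 /\
  E ^+ 2 <= 9 * q ^+ 16 * (3 * q ^+ 2 * t + (q ^+ 8 + 2 * q ^+ 6 - t ^+ 2)).
Proof.
move=> q1 t0 -> Ul Ur h.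
have q0 : 0 < q by lra.
have p k : 0 < q ^+ k by rewrite exprn_gt0.
have q62 : q ^+ 6 <= q ^+ 8 by rewrite ler_weXn2l.
have U0 : 0 < U by apply: lt_le_trans Ul.
set M := q ^+ 8 + U in h *.
have M0 : 0 < M by rewrite addr_gt0.
have M3 : M <= 3 * q ^+ 8 by rewrite /M; lra.
(* This turns the term M t of the bound into U times 3 q^2 t. *)
have MU : M <= 3 * q ^+ 2 * U.
  by have := ler_wpM2l (ltW (p 2)) Ul; rewrite -exprD; lra.
set W := 3 * q ^+ 2 * t + (q ^+ 8 + 2 * q ^+ 6 - t ^+ 2).
have hW : M * (t + U) - t ^+ 2 * U <= U * W.
  have := ler_wpM2r t0 MU; have := ler_wpM2l (ltW U0) Ur.
  rewrite /W /M; lra.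
have {h} : U * E ^+ 2 <= U * (M ^+ 2 * W).
  apply: le_trans h _; rewrite mulrCA ler_pM2l // exprn_gt0 //.
rewrite ler_pM2l // => EW.
have W0 : 0 <= W.
  by rewrite -(pmulr_rge0 _ (exprn_gt0 2 M0)); apply: le_trans EW; exact: sqr_ge0.
split.
  rewrite leNgt; apply/negP => tq; move: W0; apply/negP; rewrite -ltNge /W.
  have q24 : q ^+ 2 <= q ^+ 4 by rewrite ler_weXn2l.
  have := ler_wpM2r t0 q24; have := ler_pM _ _ (ltW tq) (ltW tq).
  have -> : q ^+ 8 = q ^+ 4 * q ^+ 4 by rewrite -exprD.
  have := p 4; have : q ^+ 6 <= q ^+ 4 * q ^+ 4 by rewrite -exprD.
  nra.
apply: le_trans EW _; apply: ler_wpM2r => //.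
have -> : 9 * q ^+ 16 = (3 * q ^+ 8) ^+ 2 by ring.
by rewrite lerXn2r // nnegrE ?mulr_ge0 // ltW.
Qed.

Lemma sidon_deviation_optimized (R : realType) (S : {fset nat}) (n : nat) (q : R) :
  sidon S -> (forall a, a \in S -> a <= n)%N -> 1 <= q -> n%:R = q ^+ 8 ->
  (#|` S|%fset)%:R <= 6 * q ^+ 4 /\
  (\sum_(a <- S) (a%:R - n%:R / 2)) ^+ 2 <=
    9 * q ^+ 16 * (3 * q ^+ 2 * (#|` S|%fset)%:R
                   + (q ^+ 8 + 2 * q ^+ 6 - (#|` S|%fset)%:R ^+ 2)).
Proof.
move=> sS Sn q1 nE; pose u := (Num.truncn (q ^+ 6)).+1.
have q6 : 1 <= q ^+ 6 by rewrite exprn_ege1.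
have /andP[ul ur] := truncn_itv (le_trans ler01 q6).
have := sidon_deviation R sS Sn (isT : 0 < u)%N; rewrite natrD.
apply: deviation_bound_of_scale => //; first exact: ltW.
by rewrite /u -natr1; lra.
Qed.

(** * From the centre of mass to the weighted sum *)

(** The difference is the sum of [(i - 1) a_i], each term of which lies between
    [0] and [t n]. *)
Lemma weighted_sum_error (R : realFieldType) (S : {fset nat}) (n : nat) :
  (forall a, a \in S -> a <= n)%N ->
  `|\sum_(1 <= i < (#|` S|%fset).+1) (n%:R + 1 - i%:R) * (nth_elt S i)%:R
    - 1 / 2 * n%:R ^+ 2 * (#|` S|%fset)%:R
    - n%:R * \sum_(a <- S) (a%:R - n%:R / 2)|
  <= (#|` S|%fset)%:R ^+ 2 * n%:R :> R.
Proof.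
move=> Sn; set t := #|` S|%fset; set N : R := n%:R.
have szS : size (sort leq S) = t by rewrite size_sort.
have sumS : \sum_(0 <= i < t) (nth 0 (sort leq S) i)%:R = \sum_(a <- S) a%:R :> R.
  rewrite -[t]szS -(big_nth 0 xpredT (fun a => a%:R)).
  by apply: perm_big; rewrite perm_sort.
have -> : \sum_(a <- S) (a%:R - N / 2) = \sum_(a <- S) a%:R - t%:R * (N / 2) :> R.
  rewrite sumrB; congr (_ - _).
  by rewrite big_const_seq count_predT iter_addr_0 -[LHS]mulr_natl.
rewrite big_add1 /= -sumS.
rewrite (eq_bigr (fun i => N * (nth 0 (sort leq S) i)%:R
                           - i%:R * (nth 0 (sort leq S) i)%:R)); last first.
  by move=> i _; rewrite /nth_elt /= -natr1; ring.
rewrite sumrB -mulr_sumr.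
set A := \sum_(0 <= i < t) _; set B := \sum_(0 <= i < t) _.
have -> : N * A - B - 1 / 2 * N ^+ 2 * t%:R - N * (A - t%:R * (N / 2)) = - B by field.
rewrite normrN ger0_norm; last by apply: sumr_ge0 => i _; rewrite -natrM ler0n.
have -> : t%:R ^+ 2 * N = \sum_(0 <= i < t) t%:R * N.
  by rewrite sumr_const_nat subn0 -[RHS]mulr_natl; ring.
apply: ler_sum_nat => i /andP[_ it]; apply: ler_pM; rewrite ?ler0n ?ler_nat //.
  exact: ltnW.
by apply: Sn; rewrite -(mem_sort leq) mem_nth // szS.
Qed.


Theorem corollary7 (R : realType) :
  exists C : R, 0 < C /\
    forall (n : nat) (S : {fset nat}),
      (0 < n)%N ->
      (forall x : nat, x \in S -> (1 <= x <= n)%N) ->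
      sidon S ->
      let t := #|` S|%fset in
      let N : R := n%:R in
      let D : R := \sum_(1 <= i < t.+1) (N + 1 - i%:R) * (nth_elt S i)%:R
                   - 1 / 2 * N ^+ 2 * t%:R in
      (N `^ (1 / 2) - N `^ (1 / 4) <= t%:R ->
         `|D| <= C * N `^ (19 / 8)) /\
      (t%:R < N `^ (1 / 2) - N `^ (1 / 4) ->
         `|D| <= C * N `^ (9 / 4) * Num.sqrt (N `^ (1 / 2) - t%:R)).
Proof.
exists 51; split=> // n S n0 Sn sS t N D.
have N1 : 1 <= N by rewrite ler1n.
have S_le a : a \in S -> (a <= n)%N by move/Sn/andP=> [].
pose q := N `^ (1 / 8).
have qE k x : k%:R / 8 = x -> N `^ x = q ^+ k.
  by move=> <-; rewrite -powR_mulrn ?powR_ge0 // -powRrM; congr (_ `^ _); field.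
have q1 : 1 <= q.
  suff: 1 `^ (1 / 8) <= q by rewrite powR1.
  by apply: ge0_ler_powR; rewrite ?nnegrE ?ler0n //; lra.
have NE : N = q ^+ 8 by rewrite -(qE 8%N 1) ?powRr1 ?ler0n //; field.
rewrite (qE 4%N (1 / 2)); last by field.
rewrite (qE 2%N (1 / 4)); last by field.
rewrite (qE 19%N (19 / 8)); last by field.
rewrite (qE 18%N (9 / 4)); last by field.
have [t6 E2] := sidon_deviation_optimized sS S_le q1 NE.
have DE := weighted_sum_error R S_le.
move: t6 E2 DE; rewrite -/t -/N -/D NE.
have : 0 <= t%:R :> R by rewrite ler0n.
set E := \sum_(a <- S) _; set T : R := t%:R => T0 T6 E2 DE.
have q0 : 0 <= q by lra.
have p k : 0 <= q ^+ k by rewrite exprn_ge0.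
have mono i j : (i <= j)%N -> q ^+ i <= q ^+ j by move=> ij; rewrite ler_weXn2l.
have DE' : `|D| <= q ^+ 8 * `|E| + T ^+ 2 * q ^+ 8.
  have := le_trans (lerB_dist D (q ^+ 8 * E)) DE.
  by rewrite normrM (ger0_norm (p 8)); lra.
split=> ht.
  (* Here t >= q^4 - q^2, so q^8 - t^2 <= 2 q^6 and the bound on E^2 is at most
     9 q^16 (18 + 4) q^6. *)
  have EA : `|E| <= 15 * q ^+ 11.
    rewrite -(ler_pXn2r (n := 2)) ?nnegrE ?mulr_ge0 // real_normK ?num_real //.
    apply: le_trans E2 _.
    have -> : (15 * q ^+ 11) ^+ 2 = 9 * q ^+ 16 * (25 * q ^+ 6) by ring.
    apply: ler_wpM2l; first by rewrite mulr_ge0.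
    have q24 : 0 <= q ^+ 4 - q ^+ 2 by rewrite subr_ge0 mono.
    have := ler_pM q24 q24 ht ht.
    have := ler_wpM2l (p 2) T6; have := p 4; have := p 6; lra.
  have TT : T ^+ 2 <= 36 * q ^+ 8.
    have -> : 36 * q ^+ 8 = (6 * q ^+ 4) ^+ 2 by ring.
    by rewrite ler_pXn2r ?nnegrE ?mulr_ge0.
  apply: le_trans DE' _.
  have := ler_wpM2l (p 8) EA; have := ler_wpM2r (p 8) TT.
  have := mono 16 19 isT; lra.
(* Now q^8 - t^2 = s (q^4 + t) <= 2 q^4 s, and q^2 <= s lets the terms of
   order q^6 be absorbed into q^4 s. *)
set s := q ^+ 4 - T; have sq : q ^+ 2 <= s by rewrite /s; lra.
have s1 : 1 <= s by apply: le_trans sq; rewrite exprn_ege1.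
have r1 : 1 <= Num.sqrt s by rewrite -sqrtr1 ler_sqrt; lra.
have EA : `|E| <= 8 * q ^+ 10 * Num.sqrt s.
  rewrite -(ler_pXn2r (n := 2)) ?nnegrE ?mulr_ge0 ?mulr_ge0 ?sqrtr_ge0 //.
  rewrite real_normK ?num_real //.
  apply: le_trans E2 _; rewrite exprMn sqr_sqrtr; last lra.
  have -> : (8 * q ^+ 10) ^+ 2 * s = 9 * q ^+ 16 * (64 / 9 * q ^+ 4 * s) by field.
  apply: ler_wpM2l; first by rewrite mulr_ge0.
  have := ler_wpM2l (p 4) sq; have := ler_wpM2l (p 2) (ltW ht).
  have T4 : T <= q ^+ 4 by have := p 2; lra.
  have : 0 <= s * (q ^+ 4 - T) by rewrite mulr_ge0; lra.
  have := p 4; have := p 6; rewrite /s; nra.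
have TT : T ^+ 2 <= q ^+ 8.
  have -> : q ^+ 8 = (q ^+ 4) ^+ 2 by ring.
  by rewrite ler_pXn2r ?nnegrE //; have := p 2; lra.
apply: le_trans DE' _.
have := ler_wpM2l (p 8) EA; have := ler_wpM2r (p 8) TT.
have := mono 16 18 isT; have := ler_wpM2l (p 18) r1.
have := mulr_ge0 (p 18) (le_trans ler01 r1); lra.
Qed.
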